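(* For the Runge-Kutta Newton-Raphson iteration defined in the context, the value of the manifold-defining function $\tilde g$ after an intermediate iteration of a sub-step is given, for each component $p\in\{1,\ldots,\tilde M_A\}$ and each $i\ge0$, by $$\tilde g_p(v_{i+1}^{n[s+1]},t^{n[s+1]})=\frac{(1-\eta^{[s]})^2}{2}\sum_{j,k}\frac{\partial^2\tilde g_p}{\partial v_j\partial v_k}(\zeta,t^{n[s+1]})\,(\Delta v_{i+1,j}^{n[s]}-\Delta v_{i,j}^{n[s]})\,(\Delta v_{i+1,k}^{n[s]}-\Delta v_{i,k}^{n[s]}),$$ where $\zeta$ is some point (possibly depending on $p$) in the orthotope (box) with opposite corners $v_i^{n[s+1]}$ and $v_{i+1}^{n[s+1]}$ and faces parallel to the axes.
   Context: Consider the differential-algebraic system for $v(t)\in\mathbb{R}^{\tilde M}$: $$\tilde B(v,t)\frac{dv}{dt}=\tilde b(v,t),\qquad \tilde g(v,t)=0,$$ where $\tilde B(v,t)$ is a $(\tilde M-\tilde M_A)\times\tilde M$ matrix, $\tilde b(v,t)\in\mathbb{R}^{\tilde M-\tilde M_A}$, $\tilde g(v,t)\in\mathbb{R}^{\tilde M_A}$, and $\tilde G=\partial\tilde g/\partial v$. The function $\tilde g$ is twice continuously differentiable in $v$, and the matrix inverses below are assumed to exist. Scheme. Let $\eta^{[s]}$ ($0\le s<S$) be the coefficients of a convex Euler Runge-Kutta scheme: $S=1$, $\eta^{[0]}=0$; or $S=2$, $(\eta^{[0]},\eta^{[1]})=(0,\tfrac12)$; or $S=3$, $(\eta^{[0]},\eta^{[1]},\eta^{[2]})=(0,\tfrac34,\tfrac13)$.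 Times of sub-steps are $t^{n[0]}=t^n$, $t^{n[s+1]}=\eta^{[s]}t^{n[0]}+(1-\eta^{[s]})(t^{n[s]}+\Delta t^n)$. Given $v^{n[0]}$ and $v^{n[s]}$ and an initial guess $\Delta v_0^{n[s]}$, set for $i\ge0$ $$v_i^{n[s+1]}=\eta^{[s]}v^{n[0]}+(1-\eta^{[s]})(v^{n[s]}+\Delta v_i^{n[s]}),\qquad \Delta v_{i+1}^{n[s]}=\mathscr{E}(v^{n[s]},\Delta v_i^{n[s]})-v^{n[s]},$$ where $$\mathscr{E}(v^{n[s]},\Delta v_i^{n[s]})=v^{n[s]}+\begin{bmatrix}\tilde B(v^{n[s]},t^{n[s]})\\(1-\eta^{[s]})\tilde G(v_i^{n[s+1]},t^{n[s+1]})\end{bmatrix}^{-1}\begin{bmatrix}\tilde b(v^{n[s]},t^{n[s]})\,\Delta t^n\\(1-\eta^{[s]})\tilde G(v_i^{n[s+1]},t^{n[s+1]})\Delta v_i^{n[s]}-\tilde g(v_i^{n[s+1]},t^{n[s+1]})\end{bmatrix}.$$ $\Delta v_{i,j}^{n[s]}$ denotes the $j$-th component of $\Delta v_i^{n[s]}$. *)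

(* Defs.v *)
From HB Require Import structures.
From mathcomp Require Import all_boot all_order all_algebra.
From mathcomp Require Import all_classical all_reals all_analysis.
Import Order.TTheory GRing.Theory Num.Theory.
Import numFieldNormedType.Exports.

Set Implicit Arguments.
Unset Strict Implicit.
Unset Printing Implicit Defensive.

Local Open Scope classical_set_scope.
Local Open Scope ring_scope.

Section Calculus.
Context {R : realType} {n : nat}.
Implicit Types (f : 'cV[R]_n -> R) (a b v : 'cV[R]_n) (j k : 'I_n).

Definition basis_vector j : 'cV[R]_n := delta_mx j 0.

Definition partial j f : 'cV[R]_n -> R := fun v => 'D_(basis_vector j) f v.

Definition has_partial j f : Prop := forall v, derivable f v (basis_vector j).

(* The derivability clauses are needed because 'D_ is total: it has a junk
   value where the directional derivative does not exist. *)
Definition twice_continuously_differentiable f : Prop :=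
  [/\ continuous f,
      forall j, has_partial j f /\ continuous (partial j f)
    & forall j k, has_partial j (partial k f) /\
                  continuous (partial j (partial k f))].

Definition orthotope a b : set 'cV[R]_n :=
  [set x | forall j,
     Num.min (a j 0) (b j 0) <= x j 0 <= Num.max (a j 0) (b j 0)].

End Calculus.

(* The system  B(v,t) dv/dt = b(v,t),  g(v,t) = 0.  Here MA is the number of
   algebraic equations, MD the number of differential equations, and the
   unknown v has M = MD + MA components, so that MD = M - MA and stacking B
   on the Jacobian of g gives a square matrix. *)
Record dae (R : realType) (MD MA : nat) := Dae {
  dae_B : 'cV[R]_(MD + MA) -> R -> 'M[R]_(MD, MD + MA);
  dae_b : 'cV[R]_(MD + MA) -> R -> 'cV[R]_MD;
  dae_g : 'cV[R]_(MD + MA) -> R -> 'cV[R]_MA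
}.

Section System.
Context {R : realType} {MD MA : nat}.
Variable D : dae R MD MA.

Definition dae_gc (p : 'I_MA) (t : R) : 'cV[R]_(MD + MA) -> R :=
  fun v => dae_g D v t p 0.

Definition dae_G (v : 'cV[R]_(MD + MA)) (t : R) : 'M[R]_(MA, MD + MA) :=
  \matrix_(p, j) partial j (dae_gc p t) v.

End System.

(* Coefficients of the one-, two- and three-stage schemes; the number S of
   stages is size eta. *)
Definition convex_euler_rk {R : realType} (eta : seq R) : Prop :=
  [\/ eta = [:: 0], eta = [:: 0; 1 / 2] | eta = [:: 0; 3 / 4; 1 / 3]].

Section Scheme.
Context {R : realType} {MD MA : nat}.
Variable D : dae R MD MA.
Variables (eta : seq R) (tn dt : R).
(* v s stands for v^{n[s]} and dv0 s for the initial guess in sub-step s. *)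
Variables (v dv0 : nat -> 'cV[R]_(MD + MA)).
Implicit Types (s i : nat) (d : 'cV[R]_(MD + MA)).

Fixpoint substep_time s : R :=
  if s is s'.+1 then
    eta`_s' * tn + (1 - eta`_s') * (substep_time s' + dt)
  else tn.

(* v_i^{n[s+1]} as a function of the increment d = Delta v_i^{n[s]}. *)
Definition stage_value s d : 'cV[R]_(MD + MA) :=
  eta`_s *: v 0 + (1 - eta`_s) *: (v s + d).

Definition newton_matrix s d : 'M[R]_(MD + MA) :=
  col_mx (dae_B D (v s) (substep_time s))
         ((1 - eta`_s) *: dae_G D (stage_value s d) (substep_time s.+1)).

Definition newton_rhs s d : 'cV[R]_(MD + MA) :=
  col_mx (dt *: dae_b D (v s) (substep_time s))
         ((1 - eta`_s) *: (dae_G D (stage_value s d) (substep_time s.+1) *m d)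
          - dae_g D (stage_value s d) (substep_time s.+1)).

Definition euler_newton s d : 'cV[R]_(MD + MA) :=
  v s + invmx (newton_matrix s d) *m newton_rhs s d.

Fixpoint increment s i : 'cV[R]_(MD + MA) :=
  if i is i'.+1 then euler_newton s (increment s i') - v s else dv0 s.

Definition iterate s i : 'cV[R]_(MD + MA) := stage_value s (increment s i).

End Scheme.

(* Main.v *)
Require Import Defs.
From mathcomp Require Import all_boot all_order all_algebra.
From mathcomp Require Import all_classical all_reals all_analysis.
From mathcomp Require Import ring.
Import Order.TTheory GRing.Theory Num.Theory.
Import numFieldNormedType.Exports.
Local Open Scope classical_set_scope.
Local Open Scope ring_scope.

(** The last block of rows of the linear system solved by one Newton step says
    that the linearization of g at the current iterate vanishes at the next
    one: if h is the difference of the two iterates, then g + G h = 0, where g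
    and its Jacobian G are taken at the current iterate
    ([newton_linearization]).  Here h is 1 - eta_s times the difference of the
    increments ([iterate_step]).  In the second order Taylor expansion of g_p
    at the current iterate, the terms of order zero and one therefore cancel,
    and the value of g_p at the next iterate is the Lagrange remainder alone.
    The factor (1 - eta_s)^2 comes from the two factors h in that remainder,
    and zeta lies on the segment between the two iterates, hence in the box
    that they span.

    The Taylor formula ([taylor2_orthotope]) is obtained by restricting g_p to
    the segment and using the one-dimensional formula ([taylor2_Rolle]).  The
    restriction is differentiated in terms of partial derivatives, with
    [derive_sum_partial]: continuity of the partial derivatives gives the usual
    sum formula for every directional derivative.  It is proved by adding one
    coordinate at a time to the direction ([is_deriveDdir]).  Applied first to
    g_p and then to its first partial derivatives, it computes the two
    derivatives required along the segment. *)

(** The difference quotients of both sides are the same function, so a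
    directional derivative is an ordinary derivative along a line; this gives
    access to the chain rule and the mean value theorem for functions of one
    real variable. *)
Lemma is_derive_alongP (R : realType) (V : normedModType R) (f : V -> R)
    (a v : V) (t df : R) :
  is_derive t 1 (fun r : R => f (r *: v + a)) df <->
  is_derive (t *: v + a) v f df.
Proof.
have quotE : (fun h : R => h^-1 *: (((fun r : R => f (r *: v + a)) \o shift t)
                                      (h *: (1 : R)) - f (t *: v + a))) =
             (fun h : R => h^-1 *: ((f \o shift (t *: v + a)) (h *: v)
                                      - f (t *: v + a))).
  apply/funext => h /=.
  by rewrite [h%:A]mulr1 scalerDl addrA.
by split=> -[ex val]; split; move: ex val;
  rewrite /derivable /derive quotE.
Qed.

(** Parametrizing by [0, 1] rather than by the interval between 0 and c treats
    both signs of c, and c = 0, at once. *)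
Lemma MVT_along (R : realType) (V : normedModType R) (f : V -> R) (e : V) :
  (forall y, derivable f y e) ->
  forall (a : V) (c : R), exists2 theta : R, 0 <= theta <= 1 &
    f (c *: e + a) - f a = c * 'D_e f ((theta * c) *: e + a).
Proof.
move=> df a c.
have dphi (r : R) : is_derive r 1 (fun r => f ((r * c) *: e + a))
                      ('D_e f ((r * c) *: e + a) * c).
  have d1 : is_derive (r * c) 1 (fun r : R => f (r *: e + a))
              ('D_e f ((r * c) *: e + a)).
    by apply/is_derive_alongP; exact: derivableP.
  have d2 : is_derive r 1 (fun r : R => r * c) c.
    apply: is_derive_eq.
    by rewrite scaler0 add0r /GRing.scale /= mulr1.
  exact: (@is_derive1_comp _ (fun r : R => f (r *: e + a)) (fun r : R => r * c)).
have [|theta] := @MVT_segment _ _ _ 0 1 ler01 (fun x _ => dphi x).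
  by apply: derivable_within_continuous => x _; exact: ex_derive.
rewrite in_itv /= => th; rewrite mul1r mul0r scale0r add0r subr0 mulr1 => ->.
by exists theta => //; rewrite mulrC.
Qed.

(** Split the increment along h (u + c e) into a step h u, which contributes
    the quotient converging to the derivative along u, and a step h c e.  By the
    mean value theorem the latter is h c times the derivative along e at a point
    that tends to x with h; continuity of that derivative at x gives the
    limit. *)
Lemma is_deriveDdir (R : realType) (V : normedModType R) (f : V -> R)
    (x u e : V) (c l : R) :
  is_derive x u f l -> (forall y, derivable f y e) ->
  {for x, continuous (fun y => 'D_e f y)} ->
  is_derive x (u + c *: e) f (l + c * 'D_e f x).
Proof.
move=> [dxu <-] df cf.
(* The intermediate point is chosen as a function of h, so that its limit can
   be taken. *)
have /choice [theta thetaP] : forall h : R, exists theta : R,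
    0 <= theta <= 1 /\
    f ((h * c) *: e + (h *: u + x)) - f (h *: u + x) =
    h * c * 'D_e f ((theta * (h * c)) *: e + (h *: u + x)).
  by move=> h; have [th ? ?] := MVT_along _ _ _ _ df (h *: u + x) (h * c); exists th.
suff cvgq : h^-1 *: ((f \o shift x) (h *: (u + c *: e)) - f x) @[h --> 0^'] -->
    'D_u f x + c * 'D_e f x.
  by split; [apply/cvg_ex; exists ('D_u f x + c * 'D_e f x) | exact: cvg_lim].
pose y h := (theta h * (h * c)) *: e + (h *: u + x).
have cvgy : y h @[h --> (0 : R)^'] --> x.
  suff: y h @[h --> (0 : R)^'] --> (0 : R) *: e + ((0 : R) *: u + x).
    by rewrite !scale0r !add0r.
  apply: cvgD; last first.
    by apply: cvgD; [apply: cvgZr_tmp; exact: nbhs_dnbhs | exact: cvg_cst].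
  (* theta is merely bounded by 1, so this factor is squeezed by |h c|. *)
  apply: cvgZr_tmp; apply: norm_cvg0.
  have hc0 : `|h * c| @[h --> (0 : R)^'] --> (0 : R).
    apply/norm_cvg0P; rewrite -[X in _ --> X](mul0r c).
    by apply: cvgMr_tmp; exact: nbhs_dnbhs.
  apply: (squeeze_cvgr _ (cvg_cst 0) hc0).
  near=> h; rewrite normr_ge0 normrM ler_piMl// ger0_norm; first last.
    by have [/andP[]] := thetaP h.
  by have [/andP[]] := thetaP h.
apply: (@cvg_trans _ ((fun h => h^-1 *: ((f \o shift x) (h *: u) - f x)
   + c * 'D_e f (y h)) @ (0 : R)^')).
  apply: near_eq_cvg; near=> h.
  have h0 : h != 0 by near: h; exact: nbhs_dnbhs_neq.
  have [_ E] := thetaP h.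
  rewrite -[X in _ = X]/(h^-1 * (f (h *: (u + c *: e) + x) - f x)).
  rewrite -[X in X + _ = _]/(h^-1 * (f (h *: u + x) - f x)).
  have -> : h *: (u + c *: e) + x = (h * c) *: e + (h *: u + x).
    by rewrite scalerDr scalerA addrA [_ *: e + _]addrC.
  rewrite -[f (_ + (_ + _))](subrK (f (h *: u + x))) E -/(y h).
  by field.
apply: cvgD; first exact: dxu.
apply: cvgMl_tmp.
exact: (cvg_comp _ _ cvgy cf).
Unshelve. all: by end_near. Qed.

(** This is where continuity of the partial derivatives matters: their mere
    existence does not make the derivative linear in the direction. *)
Lemma derive_sum_partial (R : realType) (n : nat) (f : 'cV[R]_n -> R)
    (x h : 'cV[R]_n) :
  (forall j, has_partial j f /\ continuous (partial j f)) ->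
  is_derive x h f (\sum_j h j 0 * partial j f x).
Proof.
move=> C1.
have -> : h = \sum_j h j 0 *: basis_vector j.
  rewrite [LHS]matrix_sum_delta; apply: eq_bigr => j _.
  by rewrite big_ord1.
have -> : \sum_j (\sum_k h k 0 *: basis_vector k : 'cV[R]_n) j 0 * partial j f x =
   \sum_j h j 0 * partial j f x.
  apply: eq_bigr => j _; rewrite summxE (bigD1 j)//= big1 ?addr0.
    by rewrite !mxE !eqxx mulr1.
  by move=> k kj; rewrite !mxE eq_sym (negPf kj) mulr0.
elim/big_rec2: _ => [|j l u _ dul]; first exact: is_derive0.
have [dj cj] := C1 j.
rewrite addrC [X in is_derive _ _ _ X]addrC.
by apply: is_deriveDdir => //; exact: cj.
Qed.

(** Expand phi at a moving base point t: the first order expansion at t,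
    evaluated at 1, plus K (1 - t)^2.  At t = 1 this is phi 1, and K is chosen to
    make it equal phi 1 at t = 0 too.  In its derivative the terms in phi1
    cancel, leaving (1 - t) (phi2 t - 2 K), so Rolle's theorem yields
    K = phi2 c / 2. *)
Lemma taylor2_Rolle (R : realType) (phi phi1 phi2 : R -> R) :
  (forall t : R, is_derive t 1 phi (phi1 t)) ->
  (forall t : R, is_derive t 1 phi1 (phi2 t)) ->
  exists2 c : R, 0 <= c <= 1 & phi 1 = phi 0 + phi1 0 + phi2 c / 2.
Proof.
move=> d1 d2.
pose K := phi 1 - phi 0 - phi1 0.
pose psi (t : R) := phi t + (1 - t) * phi1 t + K * (1 - t) ^+ 2.
have dpsi (t : R) : is_derive t 1 psi ((1 - t) * (phi2 t - 2 * K)).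
  have dB : is_derive t 1 (fun t : R => 1 - t) (-1).
    by apply: is_derive_eq; ring.
  rewrite /psi; apply: is_derive_eq.
  by rewrite /GRing.scale /= ; ring.
have [] := @Rolle _ psi 0 1 ltr01.
- by move=> x _; exact: ex_derive.
- by apply: derivable_within_continuous => x _; exact: ex_derive.
- by rewrite /psi /K; ring.
move=> c; rewrite in_itv/= => /andP[c0 c1] dc.
exists c; first by rewrite !ltW.
have := @derive_val _ _ _ _ _ _ _ dc; rewrite (@derive_val _ _ _ _ _ _ _ (dpsi c)).
move/eqP; rewrite mulf_eq0 subr_eq0 gt_eqF//= subr_eq0 => /eqP ->.
by rewrite /K; field.
Qed.

Lemma segment_orthotope (R : realType) (n : nat) (a h : 'cV[R]_n) (c : R) :
  0 <= c <= 1 -> orthotope a (h + a) (c *: h + a).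
Proof.
move=> /andP[c0 c1] j; rewrite !mxE ge_min le_max.
have [h0|/ltW h0] := leP 0 (h j 0).
  by apply/andP; split; apply/orP; [left|right];
    rewrite ?lerDr ?lerD2r ?mulr_ge0// ler_piMl.
by apply/andP; split; apply/orP; [right|left];
  rewrite ?gerDr ?lerD2r ?mulr_ge0_le0// ler_niMl.
Qed.

Lemma taylor2_orthotope (R : realType) (n : nat) (f : 'cV[R]_n -> R)
    (a h : 'cV[R]_n) :
  twice_continuously_differentiable f ->
  exists2 zeta, orthotope a (h + a) zeta &
    f (h + a) = f a + \sum_j h j 0 * partial j f a +
      (\sum_j \sum_k partial j (partial k f) zeta * h j 0 * h k 0) / 2.
Proof.
move=> [_ C1 C2].
pose phi1 (t : R) := \sum_k h k 0 * partial k f (t *: h + a).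
pose phi2 (t : R) :=
  \sum_k h k 0 * \sum_j h j 0 * partial j (partial k f) (t *: h + a).
have d1 (t : R) : is_derive t 1 (fun t : R => f (t *: h + a)) (phi1 t).
  by apply/is_derive_alongP; exact: derive_sum_partial.
have d2 (t : R) : is_derive t 1 phi1 (phi2 t).
  rewrite /phi1 -fct_sumE; apply: is_derive_sum => k.
  apply: is_deriveZ; apply/is_derive_alongP.
  by apply: derive_sum_partial => j; exact: C2.
have [c c01] := taylor2_Rolle _ _ _ _ d1 d2.
rewrite /phi1 scale1r scale0r add0r => ->.
exists (c *: h + a); first exact: segment_orthotope.
congr (_ + _ / 2); rewrite /phi2 exchange_big /=; apply: eq_bigr => k _.
by rewrite mulr_sumr; apply: eq_bigr => j _; ring.
Qed.

Lemma iterate_step (R : realType) (MD MA : nat) (D : dae R MD MA)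
    (eta : seq R) (tn dt : R) (v dv0 : nat -> 'cV[R]_(MD + MA)) (s i : nat) :
  let dv := increment D eta tn dt v dv0 s in
  iterate D eta tn dt v dv0 s i.+1 =
    (1 - eta`_s) *: (dv i.+1 - dv i) + iterate D eta tn dt v dv0 s i.
Proof.
move=> dv; rewrite /iterate /stage_value -/dv [RHS]addrCA -scalerDr.
by rewrite [_ - _ + _]addrCA subrK.
Qed.

(** Multiplying the Newton update by its matrix and keeping only the rows below
    those of B gives (1 - eta_s) G dv_(i+1) = (1 - eta_s) G dv_i - g. *)
Lemma newton_linearization (R : realType) (MD MA : nat) (D : dae R MD MA)
    (eta : seq R) (tn dt : R) (v dv0 : nat -> 'cV[R]_(MD + MA)) (s i : nat) :
  let dv := increment D eta tn dt v dv0 s in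
  let v_next := iterate D eta tn dt v dv0 s in
  let t_next := substep_time eta tn dt s.+1 in
  newton_matrix D eta tn dt v s (dv i) \in unitmx ->
  dae_G D (v_next i) t_next *m ((1 - eta`_s) *: (dv i.+1 - dv i)) =
    - dae_g D (v_next i) t_next.
Proof.
move=> dv v_next t_next N_unit.
have : newton_matrix D eta tn dt v s (dv i) *m dv i.+1 =
       newton_rhs D eta tn dt v s (dv i).
  by rewrite [dv i.+1]addrC addKr mulmxA mulmxV// mul1mx.
rewrite /newton_matrix /newton_rhs mul_col_mx => /eq_col_mx[_].
rewrite -/t_next -/(v_next i) => E.
rewrite -scalemxAr mulmxBr scalerBr scalemxAl E.
by rewrite addrAC subrr add0r.
Qed.

Theorem proposition4p2 (R : realType) (MD MA : nat) (D : dae R MD MA)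
    (g_C2 : forall (t : R) (p : 'I_MA),
       twice_continuously_differentiable (dae_gc D p t))
    (eta : seq R) (eta_rk : convex_euler_rk eta) (tn dt : R)
    (v dv0 : nat -> 'cV[R]_(MD + MA)) (s : nat) (s_lt : (s < size eta)%N)
    (i : nat)
    (inv_exists : forall k : nat, (k <= i)%N ->
       newton_matrix D eta tn dt v s (increment D eta tn dt v dv0 s k)
         \in unitmx)
    (p : 'I_MA) :
  let dv := increment D eta tn dt v dv0 s in
  let v_next := iterate D eta tn dt v dv0 s in
  let t_next := substep_time eta tn dt s.+1 in
  exists2 zeta : 'cV[R]_(MD + MA),
    orthotope (v_next i) (v_next i.+1) zeta &
    dae_g D (v_next i.+1) t_next p 0 =
      (1 - eta`_s) ^+ 2 / 2 *
      \sum_(j < MD + MA) \sum_(k < MD + MA)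
        partial j (partial k (dae_gc D p t_next)) zeta
        * (dv i.+1 j 0 - dv i j 0) * (dv i.+1 k 0 - dv i k 0).
Proof.
move=> dv v_next t_next.
pose h := (1 - eta`_s) *: (dv i.+1 - dv i).
have [zeta zeta_box taylor] :=
  taylor2_orthotope _ _ _ (v_next i) h (g_C2 t_next p).
exists zeta; first by rewrite [v_next i.+1]iterate_step.
have first_order0 : dae_gc D p t_next (v_next i) +
    \sum_j h j 0 * partial j (dae_gc D p t_next) (v_next i) = 0.
  have /matrixP/(_ p 0) :=
    newton_linearization _ _ _ _ _ _ _ _ _ _ _ (inv_exists i (leqnn i)).
  rewrite -/dv -/(v_next) -/t_next -/h !mxE => E.
  rewrite /dae_gc -[X in X + _]opprK -E addrC.
  apply/eqP; rewrite subr_eq0; apply/eqP/eq_bigr => j _.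
  by rewrite !mxE mulrC.
rewrite [v_next i.+1]iterate_step -/dv -/v_next -/h.
rewrite -[LHS]/(dae_gc D p t_next (h + v_next i)) taylor first_order0 add0r.
rewrite mulr_suml mulr_sumr; apply: eq_bigr => j _.
rewrite mulr_suml mulr_sumr; apply: eq_bigr => k _.
by rewrite !mxE; ring.
Qed.
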